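(* Let $\theta$ be a skew-symmetric holomorphic function satisfying the three-term relation, let $k\ge1$, and let $\check H_k^\theta(\kappa)$ be the $\kappa$-symmetrization operator built from Shibukawa--Ueno braiding elements. Then for every meromorphic function $f$ of $z_1,\dots,z_k$, $$\bigl(\check H_k^\theta(\kappa)f\bigr)(z_1,\dots,z_k)=\mathrm{Sym}_k\Bigl(\prod_{1\le i<j\le k}G^\theta(z_i-z_j,\kappa)\,f(z_1,\dots,z_k)\Bigr).$$
   Context: $\theta(z)$ is a (nonzero) holomorphic function with $\theta(-z)=-\theta(z)$ satisfying the three-term relation $$\theta(x+y)\theta(x-y)\theta(z+w)\theta(z-w)+\theta(x+z)\theta(x-z)\theta(w+y)\theta(w-y)+\theta(x+w)\theta(x-w)\theta(y+z)\theta(y-z)=0.$$ Put $G^\theta(z,w)=\frac{\theta(z+w)\theta'(0)}{\theta(z)\theta(w)}$. $\kappa\in\mathbb{C}$ is such that $\theta(m\kappa)\ne0$ for all nonzero integers $m$. $\mathcal M_k$ is the space of meromorphic functions in $z_1,\dots,z_k$, and $P_{ij}$ is the operator exchanging the variables $z_i$ and $z_j$. The Shibukawa--Ueno braiding element is the operator on $\mathcal M_k$ $$\check R^\theta_i(\xi|\kappa)=G^\theta(z_{i+1}-z_i,\kappa)P_{i,i+1}-G^\theta(z_{i+1}-z_i,\xi)\,\mathrm{Id}.$$ The $\kappa$-symmetrization operator is $$\check H_k^\theta(\kappa)=\bigl(\check R^\theta_{k-1}(-\kappa|\kappa)\cdots\check R^\theta_1(-k\kappa+\kappa|\kappa)\bigr)\cdots\bigl(\check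 R^\theta_{k-1}(-\kappa|\kappa)\check R^\theta_{k-2}(-2\kappa|\kappa)\bigr)\bigl(\check R^\theta_{k-1}(-\kappa|\kappa)\bigr),$$ i.e. the product of blocks $B_{k-1}B_{k-2}\cdots B_1$, $B_m=\check R^\theta_{k-1}(-\kappa|\kappa)\check R^\theta_{k-2}(-2\kappa|\kappa)\cdots\check R^\theta_{k-m}(-m\kappa|\kappa)$. $(\mathrm{Sym}_kF)(z_1,\dots,z_k)=\sum_{\sigma\in S_k}F(z_{\sigma(1)},\dots,z_{\sigma(k)})$. *)

(* Defs.v *)
From HB Require Import structures.
From mathcomp Require Import all_boot all_order all_fingroup all_algebra.
From mathcomp Require Import complex.
From mathcomp Require Import all_classical all_reals all_analysis.

Set Implicit Arguments.
Unset Strict Implicit.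
Unset Printing Implicit Defensive.

Import Order.TTheory GRing.Theory Num.Theory.
Import numFieldNormedType.Exports.

Local Open Scope classical_set_scope.
Local Open Scope ring_scope.

(* The complex field R[i], typed as a numClosedFieldType so that the topology
   and norm of MathComp-Analysis (attached to the numeric structures and not to
   the type constructor complex) are inferred. *)
Definition Cplx (R : realType) : numClosedFieldType := complex R.

Section Meromorphic.
Context {R : realType} {n : nat}.
Local Notation C := (Cplx R).
Implicit Types (U : set 'rV[C]_n) (F G g h : 'rV[C]_n -> C).

(* The base field of 'rV[C]_n and C^o is C, so that differentiability is
   complex differentiability. *)
Definition holomorphic_on U h : Prop :=
  forall z, U z -> differentiable (h : 'rV[C]_n -> C^o) z.

Definition nowhere_locally_zero U h : Prop :=
  forall V, open V -> V !=set0 -> V `<=` U -> exists2 z, V z & h z != 0.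

(* A meromorphic function on C^n is represented by a total function; its values
   on the zero sets of the local denominators are irrelevant. *)
Definition meromorphic F : Prop :=
  forall p, exists U g h,
    [/\ open U, U p, holomorphic_on U g, holomorphic_on U h
      & nowhere_locally_zero U h /\
        forall z, U z -> h z != 0 -> F z = g z / h z].

(* F and G represent the same element of the space of meromorphic functions:
   both are meromorphic and they agree on a dense open set. *)
Definition eq_meromorphic F G : Prop :=
  [/\ meromorphic F, meromorphic G
    & exists D, [/\ open D, dense D & forall z, D z -> F z = G z]].

End Meromorphic.

Section Theta.
Context {R : realType}.
Local Notation C := (Cplx R).
Implicit Types (theta : C -> C) (z w kappa xi : C).

Definition entire theta : Prop := forall z, derivable (theta : C -> C^o) z 1.

Definition three_term_relation theta : Prop := forall x y z w,
  theta (x + y) * theta (x - y) * theta (z + w) * theta (z - w)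
  + theta (x + z) * theta (x - z) * theta (w + y) * theta (w - y)
  + theta (x + w) * theta (x - w) * theta (y + z) * theta (y - z) = 0.

Definition Gtheta theta z w : C :=
  theta (z + w) * derive1 (theta : C -> C^o) 0 / (theta z * theta w).

End Theta.

(* Below k = n.+1 is the number of variables, and operators act on the total
   functions representing meromorphic functions. *)
Section Operators.
Context {R : realType} {n : nat}.
Local Notation C := (Cplx R).
Local Notation k := n.+1.
Local Notation fct := ('rV[C]_k -> C).
Implicit Types (theta : C -> C) (kappa xi : C) (f F : fct) (z : 'rV[C]_k).

(* Variables are numbered from 1: z_i is column i.-1, for 1 <= i <= k. *)
Definition varidx (i : nat) : 'I_k := inord i.-1.
Definition var z (i : nat) : C := z 0 (varidx i).

Definition exchange (i j : nat) f : fct :=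
  fun z => f (xcol (varidx i) (varidx j) z).

(* The braiding element, for 1 <= i < k. *)
Definition Rcheck theta (i : nat) xi kappa f : fct := fun z =>
  Gtheta theta (var z i.+1 - var z i) kappa * exchange i i.+1 f z
  - Gtheta theta (var z i.+1 - var z i) xi * f z.

(* B_m = R_{k-1}(-kappa) R_{k-2}(-2 kappa) ... R_{k-m}(-m kappa). *)
Definition block theta kappa (m : nat) : fct -> fct :=
  \big[comp/id]_(1 <= j < m.+1)
    Rcheck theta (k - j) (- (j%:R * kappa)) kappa.

(* B_{k-1} B_{k-2} ... B_1, the leftmost operator being applied last. *)
Definition Hcheck theta kappa : fct -> fct :=
  \big[comp/id]_(1 <= j < k) block theta kappa (k - j).

(* The j-th column of col_perm s z is the (s j)-th column of z. *)
Definition Symk F : fct := fun z => \sum_(s : 'S_k) F (col_perm s z).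

Definition Gprod theta kappa : fct := fun z =>
  \prod_(i < k) \prod_(j < k | (i < j)%N) Gtheta theta (z 0 i - z 0 j) kappa.

End Operators.

(* Main.v *)
Require Import Defs.
From HB Require Import structures.
From mathcomp Require Import all_boot all_order all_fingroup all_algebra.
From mathcomp Require Import complex ring zify.
From mathcomp Require Import all_classical all_reals all_analysis.

Import Order.TTheory GRing.Theory Num.Theory.
Import numFieldNormedType.Exports.

Local Open Scope ring_scope.

(* Away from the zeros of the theta (z_i - z_j) the identity holds pointwise.
   The operator B_{m-1} ... B_1 f is symmetric in its last m variables. On a
   function g symmetric in all variables after z_a, each factor of B_m only
   produces the values g_i of g with z_i moved to position a; after the factors
   up to position p the coefficient of g_i, for i < p, is
     prod_{a <= l < p, l <> i} G(z_i - z_l, kappa) * G(z_i - z_p, q kappa),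
   with -q kappa the parameter of the last factor applied, and Fay's identity (a form of
   the three-term relation) is exactly what propagates this formula. At p = k
   the coefficient is prod_{l <> i} G(z_i - z_l, kappa), and summing over i
   extends the symmetrization by one variable.
   That the zeros of theta are nowhere dense follows from the three-term
   relation and continuity alone, without the identity theorem. *)

(** * Fay's identity *)

Section Identities.
Context (R : realType) (theta : Cplx R -> Cplx R).
Local Notation C := (Cplx R).
Local Notation G := (Gtheta theta).
Hypothesis theta_odd : forall z, theta (- z) = - theta z.
Hypothesis theta_rel : three_term_relation theta.

Lemma Gtheta_opp (x y : C) : G (- x) (- y) = - G x y.
Proof. by rewrite /Gtheta -opprD !theta_odd mulrNN mulNr mulNr. Qed.

(** The three-term relation under the substitution [x = (s + v) / 2 + u], [y = t + (v - s) / 2],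
    [z = (s + v) / 2], [w = (s - v) / 2], which clears the halves from every sum and difference;
    oddness then fixes two signs. *)
Lemma theta_weierstrass (s t u v : C) :
  theta (t + u + v) * theta (s - t + u) * theta s * theta v
  - theta (s + u + v) * theta u * theta t * theta (v - s + t)
  = theta (s + u) * theta (u + v) * theta (t + v) * theta (s - t).
Proof.
have := theta_rel ((s + v) / 2 + u) (t + (v - s) / 2) ((s + v) / 2) ((s - v) / 2).
have -> : (s + v) / 2 + u + (t + (v - s) / 2) = t + u + v by field.
have -> : (s + v) / 2 + u - (t + (v - s) / 2) = s - t + u by field.
have -> : (s + v) / 2 + (s - v) / 2 = s by field.
have -> : (s + v) / 2 - (s - v) / 2 = v by field.
have -> : (s + v) / 2 + u + (s + v) / 2 = s + u + v by field.
have -> : (s + v) / 2 + u - (s + v) / 2 = u by field.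
have -> : (s - v) / 2 + (t + (v - s) / 2) = t by field.
have -> : (s - v) / 2 - (t + (v - s) / 2) = - (v - s + t) by field.
have -> : (s + v) / 2 + u + (s - v) / 2 = s + u by field.
have -> : (s + v) / 2 + u - (s - v) / 2 = u + v by field.
have -> : t + (v - s) / 2 + (s + v) / 2 = t + v by field.
have -> : t + (v - s) / 2 - (s + v) / 2 = - (s - t) by field.
rewrite !theta_odd => /eqP; rewrite !mulrN addr_eq0 => /eqP e.
by rewrite e opprK.
Qed.

(** Over the common denominator the numerator of the left side is that of [theta_weierstrass] at
    [s = a - b], [t = a - c]; the hypotheses are the nonvanishing of the six factors of that
    denominator. *)
Lemma Gtheta_fay (a b c u v : C) :
  theta (a - b) != 0 -> theta (a - c) != 0 -> theta (c - b) != 0 ->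
  theta u != 0 -> theta v != 0 -> theta (u + v) != 0 ->
  G (c - b) u * G (a - c) (u + v) + G (b - c) v * G (a - b) (u + v)
  = G (a - b) u * G (a - c) v.
Proof.
move=> ab ac cb u0 v0 uv0; rewrite /Gtheta.
have := theta_weierstrass (a - b) (a - c) u v.
have -> : a - b - (a - c) = c - b by ring.
have -> : v - (a - b) + (a - c) = b - c + v by ring.
have -> : b - c = - (c - b) by ring.
rewrite theta_odd !addrA.
set d := derive1 _ _.
set A := theta (a - c + u + v); set B := theta (c - b + u).
set A' := theta (a - b + u + v); set B' := theta (- (c - b) + v).
set E := theta (a - b + u); set E' := theta (a - c + v).
move=> e.
have -> : B * d / (theta (c - b) * theta u)
   * (A * d / (theta (a - c) * theta (u + v)))
   + B' * d / (- theta (c - b) * theta v)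
   * (A' * d / (theta (a - b) * theta (u + v)))
 = (A * B * theta (a - b) * theta v - A' * theta u * theta (a - c) * B')
   * d ^+ 2 / (theta (c - b) * theta u * theta (a - c) * theta (u + v)
     * theta v * theta (a - b)) by field; rewrite ab ac cb u0 v0 uv0.
rewrite e; field; by rewrite ab ac cb u0 v0 uv0.
Qed.
End Identities.

(** * The zeros of theta *)

Section Zeros.
Local Open Scope classical_set_scope.
Context {R : realType}.
Local Notation C := (Cplx R).

(** In the partial order of the complex numbers [0 <= x] forces [x] to be real, so the Archimedean
    property of [R] applies. *)
Lemma Cplx_archi (x : C) : 0 <= x -> exists n : nat, x < n%:R.
Proof.
move=> x0.
have xE : x = ((complex.Re x)%:C)%C :> complex R by rewrite RRe_real // ger0_real.
exists (Num.Def.archi_bound (complex.Re x)).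
have -> : (Num.Def.archi_bound (complex.Re x))%:R =
  (((Num.Def.archi_bound (complex.Re x))%:R)%:C)%C :> complex R.
  by rewrite rmorph_nat.
rewrite [X in X < _]xE ltcR; apply: archi_boundP.
by move: x0; rewrite [X in _ <= X]xE (_ : 0 = ((0 : R)%:C)%C :> complex R) // lecR.
Qed.

Lemma open_Cplx_neq0 : open [set x : C^o | x != 0].
Proof.
rewrite (_ : [set x | _] = ~` [set 0]).
  exact/closed_openC/accessible_closed_set1/hausdorff_accessible/norm_hausdorff.
by apply/seteqP; split => x /= /eqP.
Qed.

Lemma nbhs_shiftP (a : C) (B : set C) :
  nbhs a B <-> exists2 e : C, 0 < e & forall d, `|d| < e -> B (a + d).
Proof.
split=> [/(@nbhs_normP _ C^o)|] [e /= e0 eB];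
  last apply/(@nbhs_normP _ C^o); exists e => //.
  by move=> d de; apply: eB; rewrite /= opprD addrA subrr sub0r normrN.
move=> d /= de; rewrite (_ : d = a + (d - a)); last by ring.
by apply: eB; rewrite distrC.
Qed.

(** The segment from [a] to [b] is cut into [n] equal steps shorter than [e]. This takes the place
    of a connectedness argument. *)
Lemma chain_ind (Q : C -> Prop) (e : C) : 0 < e ->
  (forall a b, Q a -> `|b - a| < e -> Q b) -> forall a b, Q a -> Q b.
Proof.
move=> e0 step a b Qa.
have [n ltn] : exists n : nat, `|b - a| / e < n%:R.
  by apply: Cplx_archi; rewrite divr_ge0 // ltW.
have n0 : 0 < n%:R :> C by apply: le_lt_trans ltn; rewrite divr_ge0 // ltW.
suff H m : Q (a + m%:R * ((b - a) / n%:R)).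
  suff <- : a + n%:R * ((b - a) / n%:R) = b by [].
  by field; rewrite gt_eqF.
elim: m => [|m IH]; first by rewrite mul0r addr0.
apply: step IH _.
rewrite (_ : _ - _ = (b - a) / n%:R); last by rewrite -natr1; ring.
rewrite normrM normfV (gtr0_norm n0) ltr_pdivrMr // mulrC.
by rewrite -ltr_pdivrMr.
Qed.

Context (theta : C -> C).
Hypothesis theta_cont : continuous (theta : C -> C^o).
Hypothesis theta_odd : forall z, theta (- z) = - theta z.
Hypothesis theta_rel : three_term_relation theta.
Local Notation O := [set z | theta z != 0].

Lemma nbhs_nonzeros (a : C) : theta a != 0 -> nbhs a O.
Proof.
move=> a0; apply: open_nbhs_nbhs; split=> //.
apply: (@open_comp _ _ (theta : C -> C^o) [set x : C^o | x != 0]).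
  by move=> x _; exact: theta_cont.
exact: open_Cplx_neq0.
Qed.

Lemma closure_nonzeros_half (x v : C) :
  closure O x -> theta v != 0 -> closure O 0 -> closure O (x + v / 2).
Proof.
(* If theta vanishes near x + v / 2, the relation at (x', v / 2 + d, v / 2, 0)
   with x' near x and d near 0 reduces to
   theta x' ^ 2 theta (v + d) theta d = 0. *)
move=> Ox v0 O0 B /nbhs_shiftP[e e0 eB].
have [//|noB] := pselect ((O `&` B) !=set0); exfalso.
have B0 y : `|x + v / 2 - y| < e -> theta y = 0.
  move=> ye; apply/eqP/negPn/negP => ty; apply: noB; exists y; split => //.
  rewrite (_ : y = x + v / 2 + (y - (x + v / 2))); last by ring.
  by apply: eB; rewrite distrC.
have e2 : 0 < e / 2 by rewrite divr_gt0.
have [x' [/= tx' xx']] : O `&` [set y | `|x - y| < e / 2] !=set0.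
  apply: Ox; apply/nbhs_shiftP; exists (e / 2) => // d de.
  by rewrite /= opprD addrA subrr sub0r normrN.
(* Nonzeros of [theta] accumulate at 0, so [d] can be one of them, small enough that by continuity
   [v + d] is a nonzero as well. *)
have [d [/= td [/= d2 tvd]]] :
    O `&` ([set d | `|d| < e / 2] `&` [set d | theta (v + d) != 0]) !=set0.
  have /nbhs_shiftP[e' e'0 e'O] := nbhs_nonzeros _ v0.
  apply: O0; apply: filterI; apply/nbhs_shiftP.
    by exists (e / 2) => // d; rewrite add0r.
  by exists e' => // d; rewrite add0r; exact: e'O.
have := theta_rel x' (v / 2 + d) (v / 2) 0.
rewrite (B0 (x' + (v / 2 + d))); last first.
  rewrite (_ : _ - _ = (x - x') - d); last by ring.
  by rewrite (le_lt_trans (ler_normB _ _)) // [ltRHS](splitr e) ltrD.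
rewrite (B0 (x' + v / 2)); last first.
  rewrite (_ : _ - _ = x - x'); last by ring.
  by rewrite (lt_trans xx') // ltr_pdivrMr // ltr_pMr // ltr1n.
rewrite !mul0r !add0r addr0 subr0 (_ : v / 2 + d + v / 2 = v + d); last by field.
rewrite (_ : v / 2 + d - v / 2 = d); last by ring.
move/eqP; rewrite !mulf_eq0.
by rewrite (negPf tx') (negPf td) (negPf tvd).
Qed.

Lemma closure_nonzeros0 (a : C) : theta a != 0 -> closure O 0.
Proof.
move=> a0; have [//|nO0] := pselect (closure O 0); exfalso.
have {nO0} [B B0 BO] : exists2 B, nbhs (0 : C) B & forall y, B y -> theta y = 0.
  have [//|H] := pselect (exists2 B, nbhs (0 : C) B & forall y, B y -> theta y = 0).
  exfalso; apply: nO0 => B B0.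
  have [//|HB] := pselect ((O `&` B) !=set0); exfalso; apply: H; exists B => // y By.
  by apply/eqP/negPn/negP => ty; apply: HB; exists y.
(* One radius [e] serves two discs: [theta] vanishes on the disc around 0 and nowhere on the disc
   around [a]. *)
have /nbhs_shiftP[e e0 eB] : nbhs (0 : C) (B `&` [set d | theta (a + d) != 0]).
  apply: filterI => //; have /nbhs_shiftP[e' e'0 e'O] := nbhs_nonzeros _ a0.
  by apply/nbhs_shiftP; exists e' => // d; rewrite add0r; exact: e'O.
have z0 d : `|d| < e -> theta d = 0.
  by move=> /eB[]; rewrite add0r => /BO.
have Qa d : `|d| < e -> theta (a + d) != 0.
  by move=> /eB[]; rewrite add0r.
pose Q (b : C) := forall d, `|d| < e -> theta (b + d) != 0.
(* As theta d = 0, the relation at (a - d, a, 0, - d) reduces to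
   theta (a - d) ^ 3 theta (a + d) = 0 when theta (a - 2 d) = 0: the zeros
   keep away from the disc around a. *)
suff: Q 0.
  by move=> /(_ 0); rewrite normr0 addr0 z0 ?eqxx ?normr0 // => /(_ e0).
apply: (chain_ind _ _ e0 _ a _ Qa) => {a0 Qa eB} {}a b Qa ba h he.
(* This [d] satisfies [a - 2 d = q], where [q] is the point to be shown a nonzero; [|a - q| < 2 e]
   gives [|d| < e]. *)
set q := b + h; pose d := (a - q) / 2.
have de : `|d| < e.
  rewrite normrM normfV [`|2|]gtr0_norm // ltr_pdivrMr //.
  rewrite (_ : a - q = - (b - a) - h); last by rewrite /q; ring.
  rewrite (le_lt_trans (ler_normB _ _)) // normrN mulr_natr mulr2n.
  exact: ltrD.
have A0 : theta (a - d) != 0 by apply: Qa; rewrite normrN.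
have A1 := Qa _ de.
apply/negP => /eqP q0.
have := theta_rel (a - d) a 0 (- d).
rewrite (_ : a - d - a = - d); last by ring.
rewrite (_ : - d - a = - (a + d)); last by ring.
rewrite (_ : a - d + - d = q); last by rewrite /d; field.
rewrite (_ : - d + a = a - d); last by ring.
rewrite q0 (z0 (- d)) ?normrN // !mulr0 !mul0r !addr0 add0r subr0 theta_odd.
by move/eqP; rewrite mulrN oppr_eq0 !mulf_eq0 (negPf A0) (negPf A1).
Qed.

(** Two half-steps, by [a + 2 (y - x)] and by [- a], carry the closure from [x] to [y]; for
    [|y - x| < e / 2] the first stays in a disc of nonzeros around [a]. Chaining such moves leads
    from 0 to any point. *)
Lemma dense_nonzeros (a : C) : theta a != 0 -> forall p, closure O p.
Proof.
move=> a0 p; have O0 := closure_nonzeros0 _ a0.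
have /nbhs_shiftP[e e0 eB] := nbhs_nonzeros _ a0.
have e2 : 0 < e / 2 by rewrite divr_gt0.
refine (chain_ind (fun x => closure O x) _ e2 _ 0 p O0) => x y Ox xy.
rewrite (_ : y = (x + (a + (y - x) * 2) / 2) + (- a) / 2); last by field.
have av : theta (a + (y - x) * 2) != 0.
  by apply: eB; rewrite normrM [`|2|]gtr0_norm // -ltr_pdivlMr.
have Na : theta (- a) != 0 by rewrite theta_odd oppr_eq0.
apply: (closure_nonzeros_half _ _ _ Na O0).
exact: (closure_nonzeros_half _ _ Ox av O0).
Qed.

End Zeros.

(** * Meromorphic functions *)

Section MeromorphicFunctions.
Local Open Scope classical_set_scope.
Context {R : realType} {n : nat}.
Local Notation C := (Cplx R).
Implicit Types (U V : set 'rV[C]_n) (F G g h : 'rV[C]_n -> C).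

Lemma holomorphic_onS {U V h} : V `<=` U -> holomorphic_on U h -> holomorphic_on V h.
Proof. by move=> VU hU z /VU; exact: hU. Qed.

Lemma holomorphic_onD {U g h} : holomorphic_on U g -> holomorphic_on U h ->
  holomorphic_on U (fun z => g z + h z).
Proof. by move=> gU hU z Uz; apply: differentiableD; [exact: gU|exact: hU]. Qed.

Lemma holomorphic_onM {U g h} : holomorphic_on U g -> holomorphic_on U h ->
  holomorphic_on U (fun z => g z * h z).
Proof. by move=> gU hU z Uz; apply: (@differentiableM C); [exact: gU|exact: hU]. Qed.

Lemma holomorphic_on_cst U (c : C) : holomorphic_on U (fun=> c).
Proof. by move=> z _; exact: differentiable_cst. Qed.

Lemma nowhere_locally_zeroS {U V h} : V `<=` U -> nowhere_locally_zero U h ->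
  nowhere_locally_zero V h.
Proof. by move=> VU hU W oW W0 WV; apply: hU => // z /WV/VU. Qed.

Lemma open_nonzero {U h} : open U -> holomorphic_on U h ->
  open (U `&` [set z | h z != 0]).
Proof.
move=> oU hU; rewrite openE => z [Uz hz].
apply: filterI; first exact: open_nbhs_nbhs.
have ch : continuous_at z (h : _ -> C^o) by exact/differentiable_continuous/hU.
apply: (ch [set x | x != 0]); apply: open_nbhs_nbhs; split=> //.
exact: open_Cplx_neq0.
Qed.

(** Holomorphy of [g] makes its nonvanishing set open, so [h] can be tested on the part of [V] where
    [g] is nonzero. *)
Lemma nowhere_locally_zeroM {U g h} : open U -> holomorphic_on U g ->
  nowhere_locally_zero U g -> nowhere_locally_zero U h ->
  nowhere_locally_zero U (fun z => g z * h z).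
Proof.
move=> oU gU g0 h0 V oV V0 VU.
have [z Vz gz] := g0 V oV V0 VU.
have [] := h0 (V `&` [set z | g z != 0]).
- exact/open_nonzero/(holomorphic_onS VU).
- by exists z.
- by move=> y [/VU].
by move=> y [Vy gy] hy; exists y => //; rewrite mulf_neq0.
Qed.

Lemma meromorphic_holomorphic F : holomorphic_on setT F -> meromorphic F.
Proof.
move=> hF p; exists setT, F, (fun=> 1); split=> //; first exact: openT.
split; first by move=> V _ [z Vz] _; exists z; rewrite ?oner_neq0.
by move=> z _ _; rewrite divr1.
Qed.

Lemma meromorphicD F G : meromorphic F -> meromorphic G ->
  meromorphic (fun z => F z + G z).
Proof.
move=> mF mG p.
have [U [g [h [oU Up gU hU [h0 Fgh]]]]] := mF p.
have [U' [g' [h' [oU' Up' gU' hU' [h0' Ggh]]]]] := mG p.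
exists (U `&` U'), (fun z => g z * h' z + g' z * h z), (fun z => h z * h' z).
have s1 : U `&` U' `<=` U by move=> ? [].
have s2 : U `&` U' `<=` U' by move=> ? [].
split=> //; first exact: openI.
- by apply: holomorphic_onD; apply: holomorphic_onM;
    (exact: holomorphic_onS s1 _ || exact: holomorphic_onS s2 _).
- by apply: holomorphic_onM;
    (exact: holomorphic_onS s1 _ || exact: holomorphic_onS s2 _).
split.
  apply: nowhere_locally_zeroM; [exact: openI|exact: holomorphic_onS s1 _| |].
    exact: nowhere_locally_zeroS s1 _.
  exact: nowhere_locally_zeroS s2 _.
move=> z [Uz Uz']; rewrite mulf_eq0 negb_or => /andP[hz hz'].
by rewrite Fgh // Ggh // addf_div.
Qed.

Lemma meromorphicM F G : meromorphic F -> meromorphic G ->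
  meromorphic (fun z => F z * G z).
Proof.
move=> mF mG p.
have [U [g [h [oU Up gU hU [h0 Fgh]]]]] := mF p.
have [U' [g' [h' [oU' Up' gU' hU' [h0' Ggh]]]]] := mG p.
exists (U `&` U'), (fun z => g z * g' z), (fun z => h z * h' z).
have s1 : U `&` U' `<=` U by move=> ? [].
have s2 : U `&` U' `<=` U' by move=> ? [].
split=> //; first exact: openI.
- by apply: holomorphic_onM;
    (exact: holomorphic_onS s1 _ || exact: holomorphic_onS s2 _).
- by apply: holomorphic_onM;
    (exact: holomorphic_onS s1 _ || exact: holomorphic_onS s2 _).
split.
  apply: nowhere_locally_zeroM; [exact: openI|exact: holomorphic_onS s1 _| |].
    exact: nowhere_locally_zeroS s1 _.
  exact: nowhere_locally_zeroS s2 _.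
move=> z [Uz Uz']; rewrite mulf_eq0 negb_or => /andP[hz hz'].
by rewrite Fgh // Ggh // mulf_div.
Qed.

Lemma meromorphicV h : holomorphic_on setT h -> nowhere_locally_zero setT h ->
  meromorphic (fun z => (h z)^-1).
Proof.
move=> hh h0 p; exists setT, (fun=> 1), h; split=> //; first exact: openT.
by split=> // z _ _; rewrite div1r.
Qed.

Lemma meromorphic_cst (c : C) : meromorphic (fun _ : 'rV[C]_n => c).
Proof. exact/meromorphic_holomorphic/holomorphic_on_cst. Qed.

Lemma meromorphic_sum (I : Type) (r : seq I) (P : pred I)
    (F : I -> 'rV[C]_n -> C) :
  (forall i, P i -> meromorphic (F i)) ->
  meromorphic (fun z => \sum_(i <- r | P i) F i z).
Proof.
move=> mF; elim: r => [|i r IH].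
  rewrite (_ : (fun z => _) = fun=> 0); first exact: meromorphic_cst.
  by apply/funext => z; rewrite big_nil.
have [Pi|nPi] := boolP (P i); last first.
  by rewrite (_ : (fun z => _) = fun z => \sum_(j <- r | P j) F j z) //;
    apply/funext => z; rewrite big_cons (negPf nPi).
rewrite (_ : (fun z => _) = fun z => F i z + \sum_(j <- r | P j) F j z).
  by apply: meromorphicD => //; exact: mF.
by apply/funext => z; rewrite big_cons Pi.
Qed.

Lemma meromorphic_prod (I : Type) (r : seq I) (P : pred I)
    (F : I -> 'rV[C]_n -> C) :
  (forall i, P i -> meromorphic (F i)) ->
  meromorphic (fun z => \prod_(i <- r | P i) F i z).
Proof.
move=> mF; elim: r => [|i r IH].
  rewrite (_ : (fun z => _) = fun=> 1); first exact: meromorphic_cst.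
  by apply/funext => z; rewrite big_nil.
have [Pi|nPi] := boolP (P i); last first.
  by rewrite (_ : (fun z => _) = fun z => \prod_(j <- r | P j) F j z) //;
    apply/funext => z; rewrite big_cons (negPf nPi).
rewrite (_ : (fun z => _) = fun z => F i z * \prod_(j <- r | P j) F j z).
  by apply: meromorphicM => //; exact: mF.
by apply/funext => z; rewrite big_cons Pi.
Qed.

Lemma differentiable_col_perm (s : 'S_n) z :
  differentiable (col_perm s : 'rV[C]_n -> 'rV[C]_n) z.
Proof.
have lin : linear (col_perm s : 'rV[C]_n -> 'rV[C]_n).
  by move=> a u v; apply/matrixP => i j; rewrite !mxE.
pose f : {linear 'rV[C]_n -> 'rV[C]_n} :=
  HB.pack (col_perm s : 'rV[C]_n -> 'rV[C]_n)
    (GRing.isLinear.Build _ _ _ _ (col_perm s : 'rV[C]_n -> 'rV[C]_n) lin).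
apply: (@linear_differentiable _ _ _ f) => {}z B [P zP PB].
(* Basic neighbourhoods of matrices are boxes, and the preimage of a box is the box with permuted
   sides. *)
exists (fun i j => P i (s^-1 j)%g).
  by move=> i j; have := zP i (s^-1 j)%g; rewrite mxE permKV.
by move=> y yP; apply: PB => i j; rewrite mxE; have := yP i (s j); rewrite permK.
Qed.

Lemma meromorphic_col_perm (s : 'S_n) F :
  meromorphic F -> meromorphic (fun z => F (col_perm s z)).
Proof.
move=> mF p.
have [U [g [h [oU Up gU hU [h0 Fgh]]]]] := mF (col_perm s p).
have cs t : continuous (col_perm t : 'rV[C]_n -> 'rV[C]_n).
  by move=> z; exact/differentiable_continuous/differentiable_col_perm.
exists (col_perm s @^-1` U), (g \o col_perm s), (h \o col_perm s); split => //.
- by apply: open_comp => // z _; exact: cs.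
- move=> z Uz; apply: differentiable_comp; first exact: differentiable_col_perm.
  exact: gU.
- move=> z Uz; apply: differentiable_comp; first exact: differentiable_col_perm.
  exact: hU.
split; last by move=> z Uz hz; exact: Fgh.
move=> V oV [v Vv] VU.
have sK (z : 'rV[C]_n) : col_perm s (col_perm s^-1 z) = z.
  by rewrite -col_permM mulgV col_perm1.
have Ks (z : 'rV[C]_n) : col_perm s^-1 (col_perm s z) = z.
  by rewrite -col_permM mulVg col_perm1.
(* The image of [V] under [col_perm s] is written as a preimage under the inverse, which makes it
   open. *)
have [||z Vz|y Vy hy] := h0 (col_perm s^-1 @^-1` V).
- by apply: open_comp => // z _; exact: cs.
- by exists (col_perm s v); rewrite /= Ks.
- by have := VU _ Vz; rewrite /= sK.
by exists (col_perm s^-1 y) => //=; rewrite sK.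
Qed.

(** * Meromorphy of the functions G(z_a - z_b, xi) and density of the generic points *)

Context (theta : C -> C).
Hypothesis theta_entire : entire theta.
Hypothesis theta_odd : forall z, theta (- z) = - theta z.
Hypothesis theta_rel : three_term_relation theta.

(** The shift [xi] lets one statement serve both the numerator of [Gtheta] and, at [xi = 0], the
    denominator. *)
Lemma holomorphic_theta_sub (a b : 'I_n) (xi : C) :
  holomorphic_on setT (fun z => theta (z 0 a - z 0 b + xi)).
Proof.
move=> z _.
apply: (@differentiable_comp _ _ _ _
    (fun z : 'rV[C]_n => z 0 a - z 0 b + xi : C^o) (theta : C^o -> C^o)).
  apply: differentiableD => //.
  apply: differentiableB; exact: differentiable_coord.
exact/derivable1_diffP/theta_entire.
Qed.

Lemma continuous_entire : continuous (theta : C -> C^o).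
Proof.
move=> z; apply: (@differentiable_continuous _ C^o C^o).
exact/derivable1_diffP/theta_entire.
Qed.

(** Only coordinate [a] is moved: by density there is a nonzero [t] of [theta] near [z_a - z_b], and
    [z_a] is replaced by [t + z_b]. *)
Lemma nowhere_locally_zero_theta_sub (a b : 'I_n) :
  a != b -> (exists z, theta z != 0) ->
  nowhere_locally_zero setT (fun z => theta (z 0 a - z 0 b)).
Proof.
move=> ab [x0 tx0] V oV [z Vz] _.
have [P zP PV] : nbhs z V by exact: open_nbhs_nbhs.
have [t [/= tt Pt]] : ([set z | theta z != 0] `&` [set d | P 0 a (d + z 0 b)]) !=set0.
  apply: (dense_nonzeros _ continuous_entire theta_odd theta_rel _ tx0 (z 0 a - z 0 b)).
  have /nbhs_shiftP[e e0 eB] := zP 0 a; apply/nbhs_shiftP; exists e => // d de /=.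
  by rewrite addrAC subrK; exact: eB.
exists (\row_j (if j == a then t + z 0 b else z 0 j)).
  apply: PV => i j; rewrite mxE (ord1 i); case: eqP => [->|_] //.
  exact: nbhs_singleton.
by rewrite !mxE eqxx [b == a]eq_sym (negPf ab) addrK.
Qed.

Lemma meromorphic_Gtheta_sub (a b : 'I_n) (xi : C) : a != b -> theta xi != 0 ->
  meromorphic (fun z => Gtheta theta (z 0 a - z 0 b) xi).
Proof.
move=> ab xi0.
have t0 : exists z, theta z != 0 by exists xi.
rewrite (_ : (fun z => _) = fun z : 'rV[C]_n => theta (z 0 a - z 0 b + xi) *
  (derive1 (theta : C -> C^o) 0 / theta xi * (theta (z 0 a - z 0 b))^-1)); last first.
  by apply/funext => z; rewrite /Gtheta invfM; ring.
apply: meromorphicM; first exact/meromorphic_holomorphic/holomorphic_theta_sub.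
apply: meromorphicM; first exact: meromorphic_cst.
apply: meromorphicV; last exact: nowhere_locally_zero_theta_sub.
rewrite (_ : (fun z => _) = fun z : 'rV[C]_n => theta (z 0 a - z 0 b + 0)).
  exact: holomorphic_theta_sub.
by apply/funext => z; rewrite addr0.
Qed.

Lemma dense_nonzero {h : 'rV[C]_n -> C} : nowhere_locally_zero setT h ->
  dense [set z | h z != 0].
Proof.
move=> h0 V V0 oV; have [//|z Vz hz] := h0 V oV V0; by exists z.
Qed.

(** At these points no denominator [theta (z_i - z_j)] vanishes, and permuting the variables
    preserves this; the operator identities are proved pointwise here. *)
Definition generic (z : 'rV[C]_n) :=
  forall i j : 'I_n, i != j -> theta (z 0 i - z 0 j) != 0.

Lemma generic_open_dense : (exists z, theta z != 0) ->
  exists D, [/\ open D, dense D & forall z, D z -> generic z].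
Proof.
move=> t0.
pose h (z : 'rV[C]_n) :=
  \prod_(ij : 'I_n * 'I_n | ij.1 != ij.2) theta (z 0 ij.1 - z 0 ij.2).
(* Both properties pass together through the induction on the product, since [nowhere_locally_zeroM]
   uses holomorphy. *)
have [hh h0] : holomorphic_on setT h /\ nowhere_locally_zero setT h.
  rewrite /h; elim: index_enum => [|[i j] r [hr hr0]].
    rewrite (_ : (fun z => _) = fun=> 1); last first.
      by apply/funext => z; rewrite big_nil.
    split; first exact: holomorphic_on_cst.
    by move=> V _ [z Vz] _; exists z; rewrite ?oner_neq0.
  have [ij|ij] := boolP (i != j); last first.
    rewrite (_ : (fun z => _) = fun z : 'rV[C]_n =>
        \prod_(ij <- r | ij.1 != ij.2) theta (z 0 ij.1 - z 0 ij.2)) //.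
    by apply/funext => z; rewrite big_cons /= (negPf ij).
  rewrite (_ : (fun z => _) = fun z : 'rV[C]_n => theta (z 0 i - z 0 j) *
    \prod_(ij <- r | ij.1 != ij.2) theta (z 0 ij.1 - z 0 ij.2)); last first.
    by apply/funext => z; rewrite big_cons /= ij.
  have hij : holomorphic_on setT (fun z : 'rV[C]_n => theta (z 0 i - z 0 j)).
    rewrite (_ : (fun z => _) = fun z : 'rV[C]_n => theta (z 0 i - z 0 j + 0)).
      exact: holomorphic_theta_sub.
    by apply/funext => z; rewrite addr0.
  split; first exact: holomorphic_onM.
  apply: nowhere_locally_zeroM => //; first exact: openT.
  exact: nowhere_locally_zero_theta_sub.
exists [set z | h z != 0]; split; last 1 first.
- move=> z /= /prodf_neq0 hz i j ij; exact: (hz (i, j)).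
- by rewrite -[X in open X]setTI; apply: open_nonzero => //; exact: openT.
- exact: dense_nonzero.
Qed.

End MeromorphicFunctions.

(** * The kappa-symmetrization operator *)

Section Symmetrization.
Context (R : realType) (n : nat) (theta : Cplx R -> Cplx R).
Local Notation C := (Cplx R).
Local Notation I := 'I_n.+1.
Hypothesis theta_odd : forall z, theta (- z) = - theta z.
Hypothesis theta_rel : three_term_relation theta.
Context (kappa : C).
Hypothesis theta_kappa : forall m : nat, (0 < m)%N -> theta (m%:R * kappa) != 0.
Local Notation G := (Gtheta theta).
Local Notation generic := (generic theta).
Implicit Types (z : 'rV[C]_n.+1) (f g : 'rV[C]_n.+1 -> C) (s t u : 'S_n.+1).

Lemma generic_col_perm s z : generic z -> generic (col_perm s z).
Proof. by move=> gz i j ij; rewrite !mxE; apply: gz; rewrite (inj_eq perm_inj). Qed.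

(* Permutations of the variables of index at least a, counted from 0. *)
Definition symge (a : nat) : {group 'S_n.+1} := Sym_group [set i : I | (a <= i)%N].

Lemma symgeP a s : reflect (forall i : I, (i < a)%N -> s i = i) (s \in symge a).
Proof.
rewrite inE; apply: (iffP idP) => [sa i ia|sa].
  by apply: out_perm sa _; rewrite inE -ltnNge.
by apply/fintype.subsetP => i; rewrite !inE leqNgt; apply: contra => ia; rewrite sa.
Qed.

Lemma symge_leq a s i : s \in symge a -> (a <= s i)%N = (a <= i)%N.
Proof. by rewrite inE => /(perm_closed i); rewrite !inE. Qed.

Lemma symge_tperm a (i j : I) : (a <= i)%N -> (a <= j)%N -> tperm i j \in symge a.
Proof.
move=> ai aj; apply/symgeP => l la; apply: tpermD;
  by apply/eqP => e; move: la; rewrite -e; lia.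
Qed.

(** Describes [symge a.+1] as the stabilizer of position [a] in [symge a], which gives the coset
    decomposition behind each new block. *)
Lemma symgeS a (A : I) s : A = a :> nat ->
  (s \in symge a.+1) = (s \in symge a) && (s A == A).
Proof.
move=> Aa; apply/symgeP/andP => [sa|[/symgeP sa /eqP sA] i].
  by split; [apply/symgeP => i ia; apply: sa; lia|rewrite sa ?Aa].
rewrite ltnS leq_eqVlt => /orP[/eqP ia|/sa//].
by rewrite (_ : i = A) //; apply: val_inj; rewrite /= ia Aa.
Qed.

(** Translates to positions counted from 0, hence the index [p.+1]; oddness of [theta] absorbs both
    the minus sign of the operator and that of its parameter. *)
Lemma RcheckE (p q : nat) (P P' : I) f z :
  P = p :> nat -> P' = p.+1 :> nat ->
  Rcheck theta p.+1 (- (q%:R * kappa)) kappa f z =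
  G (z 0 P' - z 0 P) kappa * f (col_perm (tperm P P') z)
  + G (z 0 P - z 0 P') (q%:R * kappa) * f z.
Proof.
move=> Pp Pp'; rewrite /Rcheck /var /exchange /xcol /varidx /=.
rewrite (_ : inord p.+1 = P'); last by rewrite -Pp' inord_val.
rewrite (_ : inord p = P); last by rewrite -Pp inord_val.
by rewrite -[z 0 P' - z 0 P in X in _ - X]opprB Gtheta_opp // mulNr opprK.
Qed.

(* The factors of B_m with d of them applied; A and P are the positions a and
   a + d, counted from 0. *)
Lemma block_partial (a m d : nat) (A P : I) g :
  (a + m = n)%N -> (d <= m)%N -> A = a :> nat -> P = (a + d)%N :> nat ->
  (forall z u u', generic z -> u \in symge a -> u' \in symge a -> u A = u' A ->
     g (col_perm u z) = g (col_perm u' z)) ->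
  forall z, generic z ->
  (\big[comp/id]_(m.+1 - d <= j < m.+1)
    Rcheck theta (n.+1 - j) (- (j%:R * kappa)) kappa) g z =
  \sum_(i < n.+1 | (a <= i < a + d)%N)
    (\prod_(l < n.+1 | (a <= l < a + d)%N && (l != i)) G (z 0 i - z 0 l) kappa)
    * G (z 0 i - z 0 P) ((m.+1 - d)%:R * kappa) * g (col_perm (tperm A i) z)
  + (\prod_(l < n.+1 | (a <= l < a + d)%N) G (z 0 P - z 0 l) kappa)
    * g (col_perm (tperm A P) z).
Proof.
move=> amn + Aa + ginv; elim: d P => [|d IH] P dm Pd z gz.
  have PA : P = A by apply: val_inj; rewrite /= Pd Aa addn0.
  rewrite subn0 big_geq // !big_pred0; try by move=> i; apply/negbTE; lia.
  by rewrite add0r mul1r PA tperm1 col_perm1.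
have dn : (a + d < n.+1)%N by lia.
pose Q : I := Ordinal dn.
have QP : Q != P by apply/eqP => e; have := congr1 val e; rewrite /= Pd; lia.
have -> : (m.+1 - d.+1 = m - d)%N by lia.
(* The lowest index [m - d] is the leftmost factor, thus the one applied last; since [a + m = n] it
   acts on positions [a + d] and [a + d + 1], which are [Q] and [P]. *)
rewrite big_ltn; last by lia.
have -> : ((m - d).+1 = m.+1 - d)%N by lia.
have -> : (n.+1 - (m - d) = (a + d).+1)%N by lia.
rewrite /comp (@RcheckE _ _ Q P) //; last by rewrite Pd; lia.
pose E : ('rV[C]_n.+1 -> C) -> 'rV[C]_n.+1 -> C :=
  \big[comp/id]_(m.+1 - d <= j < m.+1)
    Rcheck theta (n.+1 - j) (- (j%:R * kappa)) kappa.
have := IH Q (ltnW dm) erefl; rewrite -/E => EE.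
rewrite !EE //; last exact: generic_col_perm.
set tau := tperm Q P.
have tauI (i : I) : (i < a + d)%N -> tau i = i.
  by move=> id; rewrite tpermD //; apply/eqP => e; move: id; rewrite -e /= ?Pd; lia.
have aQ : (a <= Q)%N by rewrite /=; lia.
have aP : (a <= P)%N by rewrite Pd; lia.
have aA : (a <= A)%N by rewrite Aa.
(* Both permutations send [A] to [tau i], so the symmetry of [g] identifies the two values. *)
have gtau (i : I) : (a <= i)%N ->
    g (col_perm (tperm A i) (col_perm tau z)) = g (col_perm (tperm A (tau i)) z).
  move=> ai; rewrite -col_permM; apply: ginv => //.
  - by rewrite groupM ?symge_tperm.
  - by rewrite symge_tperm // symge_leq // symge_tperm.
  - by rewrite permM !tpermL.
have sumQ (F : I -> C) : \sum_(l < n.+1 | (a <= l < a + d.+1)%N) F l =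
    \sum_(l < n.+1 | (a <= l < a + d)%N) F l + F Q.
  rewrite (bigD1 Q) /=; last by lia.
  by rewrite addrC; congr (_ + _); apply: eq_bigl => i; rewrite -val_eqE /=; lia.
have prodQ (F : I -> C) : \prod_(l < n.+1 | (a <= l < a + d.+1)%N) F l =
    F Q * \prod_(l < n.+1 | (a <= l < a + d)%N) F l.
  rewrite (bigD1 Q) /=; last by lia.
  by congr (_ * _); apply: eq_bigl => i; rewrite -val_eqE /=; lia.
have prodI (i : I) (F : I -> C) : (i < a + d)%N ->
    \prod_(l < n.+1 | (a <= l < a + d.+1)%N && (l != i)) F l =
    F Q * \prod_(l < n.+1 | (a <= l < a + d)%N && (l != i)) F l.
  move=> id; rewrite (bigD1 Q) /=; last by rewrite -val_eqE /=; lia.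
  by congr (_ * _); apply: eq_bigl => l; rewrite -!val_eqE /=; lia.
have prodN (F : I -> C) :
    \prod_(l < n.+1 | (a <= l < a + d.+1)%N && (l != Q)) F l =
    \prod_(l < n.+1 | (a <= l < a + d)%N) F l.
  by apply: eq_bigl => l; rewrite -!val_eqE /=; lia.
rewrite sumQ prodQ prodN gtau // {4 5}/tau tpermL.
have tauz i : col_perm tau z 0 i = z 0 (tau i) by rewrite mxE.
rewrite [X in _ * (_ + X * _) + _ = _](_ : _ =
    \prod_(l < n.+1 | (a <= l < a + d)%N) G (z 0 P - z 0 l) kappa); last first.
  by apply: eq_bigr => l /andP[_ ld]; rewrite !tauz (tauI l) // /tau tpermL.
set S1 := \sum_(i < _ | _) _; set S2 := \sum_(i < _ | _) _.
set S3 := \sum_(i < _ | _) _.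
(* The terms with [g_Q] and [g_P] already match; what remains are the [g_i] with [i < a + d],
   compared one by one. *)
suff -> : S3 = G (z 0 P - z 0 Q) kappa * S1
  + G (z 0 Q - z 0 P) ((m - d)%:R * kappa) * S2 by ring.
apply/esym; rewrite /S1 /S2 /S3 {S1 S2 S3}.
rewrite !mulr_sumr -big_split /=; apply: eq_bigr => i /andP[ai id].
rewrite prodI // gtau // !tauz (tauI i) // /tau tpermL -/tau.
rewrite [X in _ * (X * _ * _) + _ = _](_ : _ = \prod_(l < n.+1 |
    (a <= l < a + d)%N && (l != i)) G (z 0 i - z 0 l) kappa); last first.
  by apply: eq_bigr => l /andP[/andP[_ ld] _]; rewrite !tauz !tauI.
set X := \prod_(l < _ | _) _.
have iQ : i != Q by rewrite -val_eqE /=; lia.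
have iP : i != P by rewrite -val_eqE /=; lia.
(* With [u = kappa] and [v = (m - d) kappa], [u + v] is the argument from the previous stage and [v]
   the new one. *)
have := Gtheta_fay _ _ theta_odd theta_rel
  (z 0 i) (z 0 Q) (z 0 P) kappa ((m - d)%:R * kappa).
have -> : kappa + (m - d)%:R * kappa = (m.+1 - d)%:R * kappa.
  by rewrite subSn ?(ltnW dm) // mulrS mulrDl mul1r.
move=> fay.
rewrite [X in _ = X * _](_ : _ = X * (G (z 0 i - z 0 Q) kappa *
   G (z 0 i - z 0 P) ((m - d)%:R * kappa))); last by ring.
rewrite -fay; first by ring.
- exact: gz.
- exact: gz.
- by apply: gz; rewrite eq_sym.
- by have := theta_kappa 1 isT; rewrite mul1r.
- by apply: theta_kappa; lia.
- by apply: theta_kappa; lia.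
Qed.

(** For [d = m] the position [P] is the last one and the extra factor has argument [1 * kappa], so
    it completes the product over [l]; the separate term becomes the summand [i = ord_max]. *)
Lemma block_symge (a m : nat) (A : I) g :
  (a + m = n)%N -> A = a :> nat ->
  (forall z u u', generic z -> u \in symge a -> u' \in symge a -> u A = u' A ->
     g (col_perm u z) = g (col_perm u' z)) ->
  forall z, generic z ->
  block theta kappa m g z =
  \sum_(i < n.+1 | (a <= i)%N)
    (\prod_(l < n.+1 | (a <= l)%N && (l != i)) G (z 0 i - z 0 l) kappa)
    * g (col_perm (tperm A i) z).
Proof.
move=> amn Aa ginv z gz.
have := @block_partial a m m A ord_max g amn (leqnn m) Aa (esym amn) ginv z gz.
rewrite subSnn /block => ->.
rewrite [RHS](bigD1 ord_max) /=; last by lia.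
rewrite [LHS]addrC amn; congr (_ * _ + _).
  by apply: eq_bigl => l; rewrite -val_eqE /=; have := ltn_ord l; lia.
apply: eq_big => [l|i /andP[ai im]]; first by rewrite -val_eqE /=; have := ltn_ord l; lia.
congr (_ * _); rewrite mul1r [RHS](bigD1 ord_max) /=; last by rewrite -val_eqE /=; lia.
rewrite mulrC; congr (_ * _).
by apply: eq_bigl => l; rewrite -!val_eqE /=; have := ltn_ord l; lia.
Qed.

(** The factors of [Gprod] whose smaller index is at least [a]; the full kernel is the case
    [a = 0]. *)
Definition Wprod (a : nat) z : C :=
  \prod_(i < n.+1 | (a <= i)%N) \prod_(j < n.+1 | (i < j)%N)
    G (z 0 i - z 0 j) kappa.

(** Induction on [m]: the sum over [i] produced by the new block and the inner symmetrization merge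
    into one sum, the [tperm A i] representing the cosets of [symge a.+1] in [symge a]. *)
Lemma blocks_symge f m : (m <= n)%N -> forall z, generic z ->
  (\big[comp/id]_(n.+1 - m <= j < n.+1) block theta kappa (n.+1 - j)) f z =
  \sum_(s in symge (n - m)) Wprod (n - m) (col_perm s z) * f (col_perm s z).
Proof.
elim: m => [|m IH] mn z gz.
  (* For [m = 0] only the last position may move, so the group is trivial and the kernel is an empty
     product. *)
  rewrite !subn0 big_geq // (big_pred1 1%g) => [|s].
    rewrite col_perm1 /Wprod big1 ?mul1r // => i ni.
    by rewrite big_pred0 // => j; apply/negbTE; have := ltn_ord j; lia.
  apply/idP/eqP => [/symgeP sn|->]; last exact: group1.
  apply/permP => i; rewrite perm1.
  have [|ni] := ltnP i n; first exact: sn.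
  have [|e] := ltnP (s i) n.
    by move=> /sn /perm_inj.
  by apply: val_inj => /=; have := ltn_ord i; have := ltn_ord (s i); lia.
rewrite big_ltn; last by lia.
have -> : ((n.+1 - m.+1).+1 = n.+1 - m)%N by lia.
have -> : (n.+1 - (n.+1 - m.+1) = m.+1)%N by lia.
set g := \big[comp/id]_(_ <= j < _) _.
have {}IH : forall z, generic z -> g f z =
    \sum_(s in symge (n - m)) Wprod (n - m) (col_perm s z) * f (col_perm s z).
  by move=> y gy; apply: IH => //; exact: ltnW.
move: IH; set a := (n - m.+1)%N.
have -> : (n - m = a.+1)%N by rewrite /a; lia.
move=> IH.
have an : (a < n.+1)%N by rewrite /a; lia.
pose A : I := Ordinal an.
rewrite /comp (@block_symge a m.+1 A) //; [|by rewrite /a; lia|]; last first.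
  move=> y u u' gy ua ua' uu'; rewrite !IH; [|exact: generic_col_perm..].
  (* As [u] and [u'] agree at [A], this quotient fixes [A], and translating by it reindexes the
     inner symmetrization. *)
  have tS : (u' * u^-1)%g \in symge a.+1.
    rewrite (symgeS _ A) // groupM ?groupV //= permM -uu' permK eqxx //.
  rewrite (reindex_inj (mulIg (u' * u^-1)%g)) /=.
  apply: eq_big => [s|s _]; first by rewrite groupMr.
  by rewrite -!col_permM -!mulgA mulVg mulg1.
rewrite [RHS](partition_big (fun s => s A) (fun i : I => (a <= i)%N)) /=; last first.
  by move=> s sa; rewrite symge_leq.
apply: eq_bigr => i ai.
have ui : tperm A i \in symge a by apply: symge_tperm.
rewrite IH; last exact: generic_col_perm.
rewrite [RHS](reindex_inj (mulIg (tperm A i))) /= mulr_sumr.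
apply: eq_big => [s|s sa].
  rewrite groupMr // (symgeS _ A) //; congr (_ && _).
  by rewrite permM -(inj_eq (@perm_inj _ (tperm A i))) tpermL.
rewrite -col_permM mulrA; congr (_ * _).
have {sa} [sa sA] : (s * tperm A i)%g \in symge a /\ (s * tperm A i)%g A = i.
  move: sa; rewrite (symgeS _ A) // => /andP[sa /eqP sA].
  by rewrite groupM // permM sA tpermL.
set t := (s * _)%g in sa sA *.
(* The factors of the kernel with first index [A] become, after reindexing by [t] with [t A = i],
   the product over [l != i] coming from the block. *)
rewrite [in RHS]/Wprod [RHS](bigD1 A) //=; congr (_ * _); last first.
  by apply: eq_bigl => l; rewrite -val_eqE /=; lia.
rewrite (reindex_inj (@perm_inj _ t)) /=.
apply: eq_big => [l|l _]; last by rewrite !mxE sA.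
rewrite symge_leq // -{1}sA (inj_eq perm_inj) -val_eqE /=; lia.
Qed.

(** The case [m = n] of [blocks_symge]: [symge 0] is the whole symmetric group. *)
Lemma Hcheck_generic f z : generic z ->
  Hcheck theta kappa f z = Symk (fun z => Gprod theta kappa z * f z) z.
Proof.
move=> gz; have := blocks_symge f n (leqnn n) z gz.
rewrite subSnn /Hcheck => ->; rewrite subnn /Symk.
by apply: eq_bigl => s; apply/symgeP.
Qed.

(** * Meromorphy of the two sides of the identity *)

Hypothesis theta_entire : entire theta.

Lemma meromorphic_Rcheck (i : nat) (xi : C) f : (0 < i < n.+1)%N ->
  theta xi != 0 -> meromorphic f -> meromorphic (Rcheck theta i xi kappa f).
Proof.
move=> iN xi0 mf.
have ii : varidx (n := n) i.+1 != varidx i.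
  by rewrite /varidx -val_eqE /= !inordK; lia.
have k0 : theta kappa != 0 by have := theta_kappa 1 isT; rewrite mul1r.
rewrite /Rcheck.
rewrite (_ : (fun z => _) = fun z =>
  Gtheta theta (z 0 (varidx i.+1) - z 0 (varidx i)) kappa * exchange i i.+1 f z
  + (-1) * (Gtheta theta (z 0 (varidx i.+1) - z 0 (varidx i)) xi * f z)); last first.
  by apply/funext => z; rewrite mulN1r.
apply: meromorphicD; first apply: meromorphicM.
- exact: meromorphic_Gtheta_sub.
- exact: meromorphic_col_perm.
- apply: meromorphicM; first exact: meromorphic_cst.
  by apply: meromorphicM => //; exact: meromorphic_Gtheta_sub.
Qed.

Lemma meromorphic_block (m : nat) f : (m <= n)%N -> meromorphic f ->
  meromorphic (block theta kappa m f).
Proof.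
move=> mn mf; rewrite /block.
(* Counting the factors already applied keeps each [j] between 1 and [m], so that
   [theta (- (j kappa))] is nonzero. *)
suff: forall d, (d <= m)%N -> meromorphic ((\big[comp/id]_(m.+1 - d <= j < m.+1)
    Rcheck theta (n.+1 - j) (- (j%:R * kappa)) kappa) f).
  by move=> /(_ m (leqnn m)); rewrite subSnn.
elim=> [|d IH] dm; first by rewrite subn0 big_geq.
rewrite big_ltn; last by lia.
have -> : ((m.+1 - d.+1).+1 = m.+1 - d)%N by lia.
apply: meromorphic_Rcheck; [lia| |exact/IH/ltnW].
by rewrite theta_odd oppr_eq0 theta_kappa //; lia.
Qed.

Lemma meromorphic_Hcheck f : meromorphic f -> meromorphic (Hcheck theta kappa f).
Proof.
move=> mf; rewrite /Hcheck big_seq.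
elim/big_rec: _ => // j F; rewrite mem_index_iota => /andP[j0 jn] mF.
by apply: meromorphic_block => //; lia.
Qed.

Lemma meromorphic_Symk f : meromorphic f -> meromorphic (Symk f).
Proof. by move=> mf; apply: meromorphic_sum => s _; exact: meromorphic_col_perm. Qed.

Lemma meromorphic_Gprod : meromorphic (@Gprod R n theta kappa).
Proof.
apply: meromorphic_prod => i _; apply: meromorphic_prod => j ij.
apply: meromorphic_Gtheta_sub => //; last by have := theta_kappa 1 isT; rewrite mul1r.
by rewrite -val_eqE /= neq_ltn ij.
Qed.

End Symmetrization.

Theorem proposition3p3 (R : realType) (theta : Cplx R -> Cplx R)
    (theta_entire : entire theta)
    (theta_neq0 : exists z, theta z != 0)
    (theta_odd : forall z, theta (- z) = - theta z)
    (theta_rel : three_term_relation theta)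
    (kappa : Cplx R)
    (kappa_generic : forall m : int, m != 0 -> theta (m%:~R * kappa) != 0)
    (n : nat) (f : 'rV[Cplx R]_n.+1 -> Cplx R) (f_mero : meromorphic f) :
  eq_meromorphic (Hcheck theta kappa f)
                 (Symk (fun z => Gprod theta kappa z * f z)).
Proof.
have theta_kappa (m : nat) : (0 < m)%N -> theta (m%:R * kappa) != 0.
  by move=> m0; apply: (kappa_generic (Posz m)); rewrite eqz_nat -lt0n.
split.
- exact: meromorphic_Hcheck.
- by apply/meromorphic_Symk/meromorphicM => //; exact: meromorphic_Gprod.
have [D [oD dD DP]] := generic_open_dense (n := n.+1) _
  theta_entire theta_odd theta_rel theta_neq0.
by exists D; split=> // z /DP gz; exact: Hcheck_generic.
Qed.
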